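(* Let $G$ be a connected $d$-regular graph with vertex set $V=\{1,\ldots,n\}$, and let $\lambda_1\ge\cdots\ge\lambda_n$ be the eigenvalues of its adjacency matrix. For distinct vertices $i,k$ define $$\alpha_{ik}=\begin{cases}1+2N(i,k),& k\sim i,\\ 2N(i,k),& k\nsim i,\end{cases}\qquad \beta_{ik}=\begin{cases}3+2N(i,k),& k\sim i,\\ 2N(i,k),& k\nsim i.\end{cases}$$ Then $$-2d+\max\Big(\{\min_{k\neq i}\alpha_{ik}: i\in V\}\cup\{d\}\Big)\le\lambda_n\le\lambda_2\le 2d-\max\Big(\{\min_{k\neq i}\beta_{ik}: i\in V\}\cup\{d\}\Big).$$
   Context: Graphs are simple, finite and undirected; $k\sim i$ means $k$ and $i$ are adjacent. $N(i,k)$ denotes the number of common neighbours of distinct vertices $i$ and $k$. The adjacency matrix has $(i,j)$ entry $1$ if $i\sim j$ and $0$ otherwise. *)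

(* Defs.v *)
From mathcomp Require Import all_boot all_order all_algebra.
From mathcomp Require Import complex.

Set Implicit Arguments.
Unset Strict Implicit.
Unset Printing Implicit Defensive.

Import Order.TTheory GRing.Theory Num.Theory.

Local Open Scope nat_scope.

Section Graph.
Variables (n : nat) (e : rel 'I_n).

Definition connected_graph := forall i j : 'I_n, connect e i j.

Definition regular_graph (d : nat) := forall i : 'I_n, #|[set j | e i j]| = d.

Definition common_neighbours (i k : 'I_n) : nat :=
  #|[set j | e i j && e k j]|.

Definition alpha (i k : 'I_n) : nat :=
  if e k i then 1 + 2 * common_neighbours i k else 2 * common_neighbours i k.

Definition beta (i k : 'I_n) : nat :=
  if e k i then 3 + 2 * common_neighbours i k else 2 * common_neighbours i k.

Definition adjmx (R : pzSemiRingType) : 'M[R]_n := \matrix_(i, j) (e i j)%:R%R.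

End Graph.

(* The default [head 0 s] is the first entry of [s], so this is the minimum of
   [s] whenever [s] is nonempty. *)
Definition seq_min (s : seq nat) : nat := \big[minn/head 0 s]_(x <- s) x.

Definition min_other n (f : 'I_n -> 'I_n -> nat) (i : 'I_n) : nat :=
  seq_min [seq f i k | k <- enum 'I_n & k != i].

Local Open Scope ring_scope.

(* [lam] lists the eigenvalues of [A] with multiplicity, in nonincreasing order
   and indexed from 0: the k-th largest eigenvalue is [lam`_k.-1]. *)
Definition ordered_spectrum (R : rcfType) n (A : 'M[R]_n) (lam : n.-tuple R) :=
  sorted >=%R lam /\ char_poly A = \prod_(x <- lam) ('X - x%:P).

(* Real symmetric matrices, hence adjacency matrices of undirected graphs, do
   have an ordered spectrum. *)
Lemma ordered_spectrum_exists (R : rcfType) n (A : 'M[R]_n) :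
  A^T = A -> exists lam : n.-tuple R, ordered_spectrum A lam.
Proof.
move=> symA; pose C := R[i]; pose f := real_complex R.
pose B : 'M[C]_n := map_mx f A.
have hB : B \is hermsymmx.
  apply/is_hermitianmxP; rewrite expr0 scale1r; apply/matrixP => i j.
  rewrite !mxE -[in LHS]symA mxE.
  by apply/esym/CrealP; rewrite complex_real.
have /orthomx_spectralP BE := hermitian_normalmx hB.
have realD := hermitian_spectral_diag_real hB.
set P := spectralmx B in BE; set D := spectral_diag B in BE realD.
have uP : P \in unitmx by exact: spectral_unit.
move: P D BE realD uP => P D BE realD uP.
have PB : P *m B = diag_mx D *m P.
  by rewrite [in LHS]BE !mulmxA mulmxV // mul1mx.
have DE i : D 0 i = f (complex.Re (D 0 i)).
  by have /mxOverP /(_ 0 i) /complex_realP [k ->] := realD.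
have cpB : char_poly B = \prod_(i < n) ('X - (D 0 i)%:P).
  have -> : char_poly B = char_poly (diag_mx D).
    pose Q := map_mx polyC P.
    have QE : Q *m char_poly_mx B = char_poly_mx (diag_mx D) *m Q.
      rewrite /char_poly_mx mulmxBr mulmxBl scalar_mxC.
      by rewrite -!map_mxM PB.
    have detQ0 : \det Q != 0.
      by rewrite det_map_mx polyC_eq0 -unitfE -unitmxE.
    move/(congr1 determinant): QE; rewrite !det_mulmx mulrC.
    exact: (mulIf detQ0).
  rewrite char_poly_trig ?diag_mx_is_trig //.
  by apply: eq_bigr => i _; rewrite mxE eqxx mulr1n.
pose s := [seq complex.Re (D 0 i) | i <- enum 'I_n].
have sz : size (sort >=%R s) == n by rewrite size_sort size_map size_enum_ord.
exists (Tuple sz); split => /=.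
  by apply: sort_sorted => x y; exact: le_total.
apply: (map_poly_inj f); rewrite map_char_poly -/B cpB rmorph_prod.
rewrite (perm_big s) ?perm_sort //= big_map big_enum /=.
by apply: eq_bigr => i _; rewrite rmorphB /= map_polyX map_polyC /= {1}DE.
Qed.

(* Main.v *)
Require Import Defs.
From mathcomp Require Import all_boot all_order all_algebra.
From mathcomp Require Import ring lra.

Import Order.TTheory GRing.Theory Num.Theory.
Local Open Scope ring_scope.

(** Let [A] be the adjacency matrix. Since the all-ones vector is an
    eigenvector of [A] for [d], subtracting row [i] from all rows and deleting
    row and column [i] leaves a matrix of order [n - 1] with entries
    [A k j - A i j] whose spectrum is that of [A] with one copy of [d] removed,
    that is [lam_2 >= ... >= lam_n]. Its diagonal entry in row [k] is [- A i k],
    and the other entries of that row have absolute values summing to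
    [2 d - 2 N(i, k) - 2 A i k], so Gershgorin's theorem gives the bounds. *)

(** * Gershgorin discs and deflation of matrices with constant row sums *)

(** Take the row [k] where [z] is largest in absolute value and compare both sides with [|z k|].
    Indexing by a predicate [P] allows a vertex to be deleted without renumbering. *)
Lemma gershgorin {R : realFieldType} {I : finType} {P : pred I}
    {c : I -> I -> R} {z : I -> R} {lambda : R} :
    (exists2 k, P k & z k != 0) ->
    (forall k, P k -> lambda * z k = \sum_(j | P j) c k j * z j) ->
  exists2 k, P k & `|lambda - c k k| <= \sum_(j | P j && (j != k)) `|c k j|.
Proof.
move=> [k0 Pk0 zk0] zP.
have [k Pk kmax] := arg_maxP (fun j => `|z j|) Pk0.
exists k => //.
have zk_gt0 : 0 < `|z k| by apply: lt_le_trans (kmax _ Pk0); rewrite normr_gt0.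
have offdiag : (lambda - c k k) * z k
    = \sum_(j | P j && (j != k)) c k j * z j.
  by rewrite mulrBl zP // (bigD1 k) //= addrAC subrr add0r.
rewrite -(ler_pM2r zk_gt0) -normrM offdiag mulr_suml.
apply: le_trans (ler_norm_sum _ _ _) _; apply: ler_sum => j /andP[Pj _].
by rewrite normrM ler_wpM2l //; exact: kmax.
Qed.

Lemma char_poly_tr {R : comNzRingType} {n : nat} (A : 'M[R]_n) :
  char_poly A^T = char_poly A.
Proof.
rewrite /char_poly -[in RHS]det_tr; congr (\det _).
by apply/matrixP => i j; rewrite !mxE eq_sym.
Qed.

Lemma root_char_poly_col {F : fieldType} {n : nat} {A : 'M[F]_n} {a : F} :
  root (char_poly A) a -> exists2 v : 'cV_n, A *m v = a *: v & v != 0.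
Proof.
rewrite -char_poly_tr -eigenvalue_root_char => /eigenvalueP[v vA v0].
exists v^T; last by rewrite trmx_eq0.
by rewrite -[A]trmxK -trmx_mul vA linearZ.
Qed.

(** A change of basis whose first vector is the all-ones vector makes [A] block upper triangular,
    with diagonal blocks [d] and the deflated matrix. *)
Lemma char_poly_deflation {F : fieldType} {n : nat} {A : 'M[F]_(1 + n)} {d : F} :
    A *m (const_mx 1 : 'cV_(1 + n)) = d *: const_mx 1 ->
  char_poly A =
    ('X - d%:P) * char_poly (drsubmx A - const_mx 1 *m ursubmx A).
Proof.
move=> A1.
set B := drsubmx A - _.
pose L : 'M[F]_(1 + n) := block_mx 1%:M 0 (const_mx 1) 1%:M.
pose U : 'M[F]_(1 + n) := block_mx d%:M (ursubmx A) 0 B.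
(* The first block column is the eigenvector equation for the all-ones vector, the second is the
   definition of [B]. *)
have AL : A *m L = L *m U.
  move: A1; rewrite -{1}[A]submxK -[const_mx 1]vsubmxK.
  have -> : usubmx (const_mx 1 : 'cV[F]_(1 + n)) = 1%:M.
    by apply/matrixP => i j; rewrite !mxE !ord1.
  have -> : dsubmx (const_mx 1 : 'cV[F]_(1 + n)) = const_mx 1.
    by apply/matrixP => i j; rewrite !mxE.
  rewrite mul_block_col scale_col_mx => /eq_col_mx[eu ed].
  rewrite -{1}[A]submxK /L /U !mulmx_block !mulmx0 !mul0mx !mul1mx !mulmx1.
  rewrite ?mulmx1 in eu ed *.
  rewrite eu ed !add0r !addr0 mul_mx_scalar scalemx1.
  by rewrite /B addrC subrK.
pose Q := map_mx polyC L.
have QE : char_poly_mx A *m Q = Q *m char_poly_mx U.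
  by rewrite /char_poly_mx mulmxBr mulmxBl -!map_mxM AL -scalar_mxC.
have detQ : \det Q = 1.
  by rewrite det_map_mx det_lblock !det1 mulr1.
have -> : char_poly A = char_poly U.
  move/(congr1 determinant): QE.
  by rewrite !det_mulmx detQ mul1r mulr1.
rewrite /char_poly.
have -> : char_poly_mx U
    = block_mx ('X - d%:P)%:M (- map_mx polyC (ursubmx A)) 0 (char_poly_mx B).
  rewrite /char_poly_mx /U map_block_mx (scalar_mx_block 1 n) opp_block_mx.
  rewrite add_block_mx add0r map_mx0 subr0 map_scalar_mx .
  by rewrite (raddfB (@scalar_mx _ 1)).
by rewrite det_ublock det_scalar1.
Qed.

(* Eigenvectors of the deflated matrix, in a form which does not depend on the
   deleted vertex: [y] is only determined up to an additive constant. *)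
Lemma deflated_eigenvector {F : fieldType} {n : nat} {A : 'M[F]_n.+1} {d : F}
    {s : seq F} {lambda : F} :
    (forall i, \sum_j A i j = d) ->
    char_poly A = \prod_(x <- d :: s) ('X - x%:P) -> lambda \in s ->
  exists y : 'I_n.+1 -> F,
    (exists k, y k != y ord0) /\
    forall i k,
      lambda * (y k - y i) = \sum_j (A k j - A i j) * (y j - y i).
Proof.
move=> rowA cpA lam_s.
have A1 : A *m (const_mx 1 : 'cV_(1 + n)) = d *: const_mx 1.
  apply/matrixP => i j; rewrite !mxE mulr1 -(rowA i).
  by apply: eq_bigr => k _; rewrite mxE mulr1.
move: (char_poly_deflation (A := A) A1); rewrite cpA big_cons.
(* Only one factor is cancelled, so [lambda] may still equal [d]. *)
move/(mulfI (monic_neq0 (monicXsubC d))) => cpB.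
have : root (\prod_(x <- s) ('X - x%:P)) lambda by rewrite root_prod_XsubC.
rewrite cpB => /root_char_poly_col[v vB v0].
(* The eigenvector is extended by 0 at the deleted vertex. *)
pose w : 'cV_(1 + n) := col_mx 0 v.
pose y (k : 'I_n.+1) := w k 0.
have y0 : y ord0 = 0.
  have -> : ord0 = lshift n (ord0 : 'I_1) by apply: val_inj.
  by rewrite /y /w (col_mxEu 0 v) mxE.
have yS k : y (rshift 1 k) = v k 0 by rewrite /y /w (col_mxEd 0 v).
have base k : lambda * y k = \sum_j (A k j - A ord0 j) * y j.
  have -> : \sum_j (A k j - A ord0 j) * y j
      = \sum_j (A k (rshift 1 j) - A ord0 (rshift 1 j)) * v j 0.
    rewrite (big_ord_recl n) y0 mulr0 add0r; apply: eq_bigr => j _.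
    have -> : lift ord0 j = rshift 1 j by apply: val_inj.
    by rewrite yS.
  have [->|[k' ->]] : k = ord0 \/ exists k', k = rshift 1 k'.
    case: (unliftP ord0 k) => [k' ->|->]; [right|by left].
    by exists k'; apply: val_inj.
  - by rewrite y0 mulr0 big1 // => j _; rewrite subrr mul0r.
  rewrite yS; move/matrixP/(_ k' 0): vB; rewrite !mxE => <-.
  apply: eq_bigr => j _; rewrite !mxE big_ord1 !mxE mul1r.
  by congr ((_ - A _ _) * _); apply: val_inj.
exists y; split.
  have /cV0Pn[k vk] := v0.
  by exists (rshift 1 k); rewrite y0 yS.
move=> i k.
(* Subtracting the identities for [k] and [i] eliminates row [ord0]; shifting [y] by [y i] changes
   nothing because rows [k] and [i] have equal sums. *)
rewrite mulrBr !base -sumrB.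
rewrite [RHS](eq_bigr (fun j => (A k j - A i j) * y j - (A k j - A i j) * y i));
  last by move=> j _; rewrite mulrBr.
rewrite [RHS]sumrB -mulr_suml [in RHS]sumrB !rowA subrr mul0r subr0.
by apply: eq_bigr => j _; rewrite -mulrBl; congr (_ * _); ring.
Qed.

(** * Adjacency matrices of regular graphs *)

Section RegularGraph.
Variables (R : realFieldType) (n d : nat) (e : rel 'I_n).
Hypotheses (e_sym : symmetric e) (e_irr : irreflexive e).
Hypothesis e_reg : regular_graph e d.

Lemma adjmx_row_sum (i : 'I_n) : \sum_j adjmx e R i j = d%:R.
Proof.
rewrite -(e_reg i) -sum1dep_card natr_sum [RHS]big_mkcond /=.
by apply: eq_bigr => j _; rewrite mxE; case: (e i j).
Qed.

(** For [a] and [b] in {0, 1}, [|b - a| = b + a - 2 * (a * b)]; the products sum to the number of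
    common neighbours. *)
Lemma adjmx_row_dist (i k : 'I_n) :
  \sum_j `|adjmx e R k j - adjmx e R i j|
  = 2 * d%:R - 2 * (common_neighbours e i k)%:R.
Proof.
have -> : (common_neighbours e i k)%:R
    = \sum_j adjmx e R i j * adjmx e R k j :> R.
  rewrite /common_neighbours -sum1dep_card natr_sum [LHS]big_mkcond /=.
  apply: eq_bigr => j _; rewrite !mxE.
  by case: (e i j); case: (e k j); rewrite ?mulr1 ?mulr0.
rewrite mulr_sumr mulrDl mul1r -{1}(adjmx_row_sum k) -(adjmx_row_sum i).
rewrite -big_split -sumrB; apply: eq_bigr => j _; rewrite !mxE /=.
case: (e k j); case: (e i j);
  rewrite ?subrr ?subr0 ?sub0r ?normrN ?normr1 ?normr0 /=; ring.
Qed.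

Lemma adjmx_eigenvalue_norm (lambda : R) :
  root (char_poly (adjmx e R)) lambda -> `|lambda| <= d%:R.
Proof.
move=> /root_char_poly_col[v Av v0].
have /cV0Pn[k vk] := v0.
have [||l _] := @gershgorin R 'I_n predT (adjmx e R) (v^~ 0) lambda.
- by exists k.
- by move=> l _; move/matrixP/(_ l 0): Av; rewrite !mxE => <-.
rewrite {1}mxE e_irr subr0 => /le_trans; apply.
rewrite -(adjmx_row_sum l) [leRHS](bigD1 l) //= {1}mxE e_irr add0r.
by apply: ler_sum => j _; rewrite ger0_norm // mxE ler0n.
Qed.

(** If [k] is adjacent to [i], the disc has centre -1 and radius [2d - 2N - 2], whence the 1 in
    [alpha] and the 3 in [beta]; otherwise it has centre 0 and radius [2d - 2N]. *)
Lemma adjmx_deflated_bound {i : 'I_n} {y : 'I_n -> R} {lambda : R} :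
    (exists k, y k != y i) ->
    (forall k, lambda * (y k - y i)
       = \sum_j (adjmx e R k j - adjmx e R i j) * (y j - y i)) ->
  exists2 k, k != i &
    - (2 * d)%:R + (alpha e i k)%:R <= lambda <= (2 * d)%:R - (beta e i k)%:R.
Proof.
move=> [k0 yk0] yP.
have [||k ki] := @gershgorin R 'I_n (fun j => j != i)
  (fun k j => adjmx e R k j - adjmx e R i j) (fun j => y j - y i) lambda.
- exists k0; last by rewrite subr_eq0.
  by apply: contraNneq yk0 => ->.
- by move=> k _; rewrite yP (bigD1 i) //= subrr mulr0 add0r.
have := adjmx_row_dist i k.
(* The radius is the distance of rows [i] and [k] without the terms of columns [i] and [k]. *)
rewrite (bigD1 i) //= (bigD1 k) //= => dist bound.
exists k => //; move: dist bound; set r := \sum_(j | _) _.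
rewrite !mxE !e_irr (e_sym i k) /alpha /beta.
rewrite !subr0 !sub0r normrN.
case: (e k i) => /=; rewrite ?normr1 ?normr0 !(natrD, natrM) ler_norml => dist;
  move=> /andP[]; lra.
Qed.

End RegularGraph.

(** * Minima and maxima of natural numbers *)

Lemma seq_min_le (s : seq nat) (x : nat) : x \in s -> (seq_min s <= x)%N.
Proof.
rewrite /seq_min; elim: s (head _ _) => // z s IHs h; rewrite inE big_cons geq_min.
by case/predU1P=> [->|/IHs->]; rewrite ?leqnn ?orbT.
Qed.

Lemma min_other_le {n : nat} {f : 'I_n -> 'I_n -> nat} {i k : 'I_n} :
  k != i -> (min_other f i <= f i k)%N.
Proof. by move=> ki; rewrite seq_min_le // map_f // mem_filter ki mem_enum. Qed.

Lemma natr_bigmax_le {R : realDomainType} {I : finType} (F : I -> nat) (m : nat)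
    (c : R) :
    m%:R <= c -> (forall i, (F i)%:R <= c) ->
  (maxn (\max_i F i) m)%:R <= c.
Proof.
(* An empty maximum is 0, so [0 <= c] is needed to start the induction. *)
move=> mc Fc; have c0 : 0 <= c by apply: le_trans mc; rewrite ler0n.
have maxc p q : p%:R <= c -> q%:R <= c -> (maxn p q)%:R <= c.
  by rewrite /maxn; case: ifP.
by apply: (maxc) => //; apply: (big_ind (fun p => p%:R <= c)).
Qed.

Theorem theorem3p7 (R : rcfType) (n d : nat) (e : rel 'I_n)
    (n_gt1 : (1 < n)%N) (e_sym : symmetric e) (e_irr : irreflexive e)
    (e_conn : connected_graph e) (e_reg : regular_graph e d)
    (lam : n.-tuple R) (lamP : ordered_spectrum (adjmx e R) lam) :
  [/\ - (2 * d)%:R + (maxn (\max_(i < n) min_other (alpha e) i) d)%:R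
        <= lam`_n.-1,
      lam`_n.-1 <= lam`_1
    & lam`_1 <=
        (2 * d)%:R - (maxn (\max_(i < n) min_other (beta e) i) d)%:R].
Proof.
case: lamP => lam_sorted cpA.
case: n n_gt1 e e_sym e_irr e_conn e_reg lam lam_sorted cpA => // n n_gt0 e
  e_sym e_irr _ e_reg lam lam_sorted cpA.
have [d' [s lamE]] : exists d' s, tval lam = d' :: s.
  by move: (size_tuple lam); case: (tval lam) => // d' s _; exists d', s.
have sz : size s = n by have := size_tuple lam; rewrite lamE => -[].
rewrite lamE in lam_sorted cpA *.
have lam_norm x : x \in d' :: s -> `|x| <= d%:R.
  move=> xs; apply: (adjmx_eigenvalue_norm _ _ _ _ e_irr e_reg).
  by rewrite cpA root_prod_XsubC.
(* The largest eigenvalue is [d]: the all-ones vector makes [d] an eigenvalue, and no eigenvalue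
   exceeds it. *)
have dd' : d%:R = d'.
  have : d%:R \in d' :: s.
    rewrite -root_prod_XsubC -cpA -char_poly_tr -eigenvalue_root_char.
    apply/eigenvalueP; exists (const_mx 1).
      apply/matrixP => i j; rewrite !mxE mulr1 -(adjmx_row_sum R _ _ _ e_reg j).
      by apply: eq_bigr => k _; rewrite !mxE mul1r.
    by apply/eqP => /matrixP/(_ 0 0)/eqP; rewrite !mxE oner_eq0.
  rewrite inE => /predU1P[//|ds]; apply/le_anti/andP; split.
    move: lam_sorted => /=; rewrite path_sortedE; last exact: rev_trans le_trans.
    by case/andP=> /allP/(_ _ ds).
  by apply: le_trans (ler_norm _) (lam_norm _ _); rewrite mem_head.
rewrite -{}dd' in lam_sorted cpA lam_norm *.
have lam_bound x : x \in s -> forall i, exists2 k, k != i &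
    - (2 * d)%:R + (alpha e i k)%:R <= x <= (2 * d)%:R - (beta e i k)%:R.
  move=> xs i.
  have [y [[k yk] yP]] :=
    deflated_eigenvector (adjmx_row_sum R _ _ _ e_reg) cpA xs.
  apply: (adjmx_deflated_bound R n.+1 d e e_sym e_irr e_reg _ (yP i)).
  (* As [y] is not constant, [k] or [ord0] has a value other than [y i]. *)
  have [yk_i|] := eqVneq (y k) (y i); last by exists k.
  by exists ord0; rewrite -yk_i eq_sym.
(* There are now [n.+1] vertices, so index [n] is the smallest eigenvalue. *)
have sP j : (0 < j <= n)%N -> (d%:R :: s)`_j \in s.
  by case: j => // j jn; rewrite /= mem_nth // sz.
have d_norm j : (0 < j <= n)%N -> - d%:R <= (d%:R :: s)`_j <= d%:R.
  by move=> /sP js; rewrite -ler_norml lam_norm // inE js orbT.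
have n_range : (0 < n <= n)%N by rewrite leqnn andbT.
have one_range : (0 < 1 <= n)%N by [].
split.
(* The entry [d] of the maximum is handled by [|x| <= d]; for each [i], the minimum is at most the
   value at the [k] found by Gershgorin. *)
- rewrite addrC -lerBrDr opprK; apply: natr_bigmax_le => [|i].
    by case/andP: (d_norm _ n_range); rewrite natrM; lra.
  have [k ki /andP[bound _]] := lam_bound _ (sP _ n_range) i.
  apply: (@le_trans _ _ (alpha e i k)%:R); first by rewrite ler_nat min_other_le.
  by move: bound; rewrite -lerBrDl opprK.
- apply: (sorted_leq_nth _ _ 0 lam_sorted).
  + exact: rev_trans le_trans.
  + exact: lexx.
  + by rewrite inE /= sz ltnS.
  + by rewrite inE /= sz.
  + exact: n_gt0.
- rewrite lerBrDr addrC -lerBrDr; apply: natr_bigmax_le => [|i].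
    by case/andP: (d_norm _ one_range); rewrite natrM; lra.
  have [k ki /andP[_ bound]] := lam_bound _ (sP _ one_range) i.
  apply: (@le_trans _ _ (beta e i k)%:R); first by rewrite ler_nat min_other_le.
  by rewrite lerBrDr addrC -lerBrDr.
Qed.
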